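(* Let $\mathcal{H}$ be a real Hilbert space and $M:\mathcal{H}\to\mathcal{H}$ a monotone and continuous operator with $\mathrm{Zer}\,M\neq\emptyset$. Let $t_0>0$, $x_0\in\mathcal{H}$, and let $x:[t_0,+\infty)\to\mathcal{H}$ be the trajectory solution of the dynamical system $$\dot x(t)+M(x(t))+\frac1t\,x(t)=0,\qquad x(t_0)=x_0 .$$ Then the following statements are true: (i) as $t\to+\infty$ it holds $\|\dot x(t)\|=\mathcal{O}\left(\frac1t\right)$ and $\|M(x(t))\|=\mathcal{O}\left(\frac1t\right)$; (ii) $x(t)$ converges strongly to the minimum norm solution $\xi_*:=P_{\mathrm{Zer}\,M}(0)$ as $t\to+\infty$.
   Context: $M$ is monotone if $\langle M(x)-M(y),x-y\rangle\ge 0$ for all $x,y\in\mathcal{H}$. $\mathrm{Zer}\,M:=\{x\in\mathcal{H}: M(x)=0\}$, which is closed and convex; $P_{\mathrm{Zer}\,M}$ is the metric projection onto it. It is assumed that the system admits a unique strong global solution, i.e. a function $x:[t_0,+\infty)\to\mathcal{H}$ that is absolutely continuous on every compact interval $[t_0,T]$, satisfies the equation almost everywhere and the initial condition, and for which moreover $t\mapsto M(x(t))$ is absolutely continuous on every compact interval $[t_0,T]$; this is ''the trajectory solution''. Estimates involving $\dot x(t)$ are understood for almost every $t$. *)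

(* Defs.v *)
From HB Require Import structures.
From mathcomp Require Import all_boot all_order all_algebra.
From mathcomp Require Import all_classical all_reals all_analysis.

Set Implicit Arguments.
Unset Strict Implicit.
Unset Printing Implicit Defensive.

Import Order.TTheory GRing.Theory Num.Theory.
Import numFieldNormedType.Exports.

Local Open Scope classical_set_scope.
Local Open Scope ring_scope.

(* With H complete for its norm, this makes (H, ip) a real Hilbert space. *)
Definition norm_induced_by (R : realType) (H : normedModType R)
    (ip : {dot H for idfun}) : Prop :=
  forall u : H, `|u| ^+ 2 = ip u u.

Definition monotone_operator (R : realType) (H : normedModType R)
    (ip : {dot H for idfun}) (M : H -> H) : Prop :=
  forall u v : H, 0 <= ip (M u - M v) (u - v).

Definition Zer (R : realType) (H : normedModType R) (M : H -> H) : set H :=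
  [set u | M u = 0].

(* Set-valued: [metric_projection C u = [set p]] says that P_C(u) is well
   defined and equal to p. *)
Definition metric_projection (R : realType) (H : normedModType R)
    (C : set H) (u : H) : set H :=
  [set p | C p /\ forall q, C q -> `|u - p| <= `|u - q|].

Definition absolutely_continuous_on (R : realType) (H : normedModType R)
    (a b : R) (f : R -> H) : Prop :=
  forall e : R, 0 < e -> exists2 d : R, 0 < d &
    forall (n : nat) (s t : 'I_n -> R),
      (forall i, a <= s i /\ s i <= t i /\ t i <= b) ->
      trivIset setT (fun i => [set` `]s i, t i[]) ->
      \sum_(i < n) (t i - s i) < d ->
      \sum_(i < n) `|f (t i) - f (s i)| < e.

(* Functions on [t0, +oo[ are represented by total functions on R; only their
   values on [t0, +oo[ are constrained. *)
Definition strong_global_solution (R : realType) (H : normedModType R)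
    (M : H -> H) (t0 : R) (x0 : H) (x : R -> H) : Prop :=
  [/\ forall T : R, t0 <= T -> absolutely_continuous_on t0 T x,
      forall T : R, t0 <= T -> absolutely_continuous_on t0 T (M \o x),
      {ae lebesgue_measure, forall t : R, t0 < t ->
         derivable x t 1 /\ derive1 x t + M (x t) + t^-1 *: x t = 0} &
      x t0 = x0].

Definition trajectory_solution (R : realType) (H : normedModType R)
    (M : H -> H) (t0 : R) (x0 : H) (x : R -> H) : Prop :=
  strong_global_solution M t0 x0 x /\
  forall y : R -> H, strong_global_solution M t0 x0 y ->
    forall t : R, t0 <= t -> y t = x t.

(* Landau notation needs filters packed with their properties. *)
Canonical pinfty_filter_on (R : realType) :=
  FilterType (pinfty_nbhs R) (@proper_pinfty_nbhs R).

(* P holds at almost every sufficiently large t. *)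
Definition ae_pinfty (R : realType) : set_system R :=
  [set P | exists T : R, {ae lebesgue_measure, forall t : R, T < t -> P t}].
Arguments ae_pinfty : clear implicits.

Lemma ae_pinfty_filter (R : realType) : Filter (ae_pinfty R).
Proof.
have aeF : Filter (almost_everywhere (@lebesgue_measure R)).
  exact: ae_filter_ringOfSetsType.
split.
- by exists 0; apply: aeW.
- move=> P Q [S hP] [T hQ]; exists (Num.max S T).
  apply: (@filterS2 _ _ aeF _ _ _ _ hP hQ) => t Pt Qt.
  by rewrite gt_max => /andP[ltS ltT]; split; [exact: Pt | exact: Qt].
- move=> P Q PQ [T hP]; exists T.
  by apply: (@filterS _ _ aeF _ _ _ hP) => t Pt ltT; exact/PQ/Pt.
Qed.

Canonical ae_pinfty_filter_on (R : realType) :=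
  FilterType (ae_pinfty R) (@ae_pinfty_filter R).

(* Main.v *)
Require Import Defs.
From HB Require Import structures.
From mathcomp Require Import all_boot all_order all_algebra.
From mathcomp Require Import all_classical all_reals all_analysis.
From mathcomp Require Import measurable_realfun ring lra.

(** Monotonicity of [M] gives, for [xi] in [Zer M], a differential inequality
    for [`|x t - xi| ^+ 2] which makes the trajectory bounded.

    The trajectory is in fact C^1: [x] is absolutely continuous and its
    derivative agrees almost everywhere with the continuous function
    [- M (x t) - t^-1 *: x t], so a mean value inequality for absolutely
    continuous functions ([ac_mean_value]) turns the almost everywhere equation
    into an equation at every [t > t0].

    Rates.  Formally, differentiating the equation and pairing it with the
    velocity [v] gives [<v', v> + `|v| ^+ 2 / t - <x, v> / t ^+ 2 <= 0], that is,
    [t ^+ 2 * `|v t| ^+ 2 - `|x t| ^+ 2] is nonincreasing.  As [x] is bounded,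
    [`|v t|] is O(1/t), and the equation transfers this rate to [`|M (x t)|].
    The second derivative need not exist pointwise, so the argument is run on
    the difference quotients [h^-1 *: (x (t + h) - x t)], for which monotonicity
    of [M] plays the same role, and then [h] tends to 0.  The convergence of the
    quotients is only locally uniform; the local estimates are glued by
    induction on intervals ([interval_cousin]).

    Strong convergence.  Let [xi] be the zero of least norm.  Along a sequence of
    times with [<xi, xi - x t> > e], the closed convex conditions
    [<xi, xi - z> >= e] and [<M y, z - y> <= r * (B + `|y|)], for all [y], hold
    at [z = x t] with [r] tending to 0, because [M (x t)] tends to 0.  Nested
    closed convex sets of a Hilbert space that all meet a fixed ball have a
    common point ([nested_convex_min_norm]); here it is a zero of [M] by Minty's argument, and
    violates the variational inequality characterizing [xi].  Hence
    [<xi, xi - x t> <= e] for large [t], which makes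
    [t ^+ 2 * (`|x t - xi| ^+ 2 - e)] nonincreasing for large [t]. *)

Set Implicit Arguments.
Unset Strict Implicit.
Unset Printing Implicit Defensive.

Import Order.TTheory GRing.Theory Num.Theory.
Import numFieldNormedType.Exports.

Local Open Scope classical_set_scope.
Local Open Scope ring_scope.

(** * Inner product and norm *)

Section InnerProduct.
Context (R : realType) (H : normedModType R) (ip : {dot H for idfun}).

Lemma ipC u v : ip u v = ip v u.
Proof. by rewrite (@hermitian_subproof _ _ _ _ ip u v) expr0 mul1r. Qed.

Lemma ipZl a u v : ip (a *: u) v = a * ip u v.
Proof. exact: linearZl_LR. Qed.

Lemma ipZr a u v : ip u (a *: v) = a * ip u v.
Proof. by rewrite ipC ipZl ipC. Qed.

Lemma ipBl u v w : ip (u - v) w = ip u w - ip v w.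
Proof. exact: linearBl. Qed.

Lemma ipBr u v w : ip w (u - v) = ip w u - ip w v.
Proof. exact: linearBr. Qed.

Lemma ipDl u v w : ip (u + v) w = ip u w + ip v w.
Proof. exact: linearDl. Qed.

Lemma ipDr u v w : ip w (u + v) = ip w u + ip w v.
Proof. exact: linearDr. Qed.

Lemma ipNl u v : ip (- u) v = - ip u v.
Proof. exact: linearNl. Qed.

Lemma ipNr u v : ip u (- v) = - ip u v.
Proof. exact: linearNr. Qed.

Lemma ip0l v : ip 0 v = 0.
Proof. exact: linear0l. Qed.

Lemma ip0r v : ip v 0 = 0.
Proof. exact: linear0r. Qed.

Hypothesis ipE : norm_induced_by ip.

Lemma normD_sqr u v : `|u + v| ^+ 2 = `|u| ^+ 2 + 2 * ip u v + `|v| ^+ 2.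
Proof. by rewrite !ipE ipDl !ipDr (ipC v u); ring. Qed.

Lemma normB_sqr u v : `|u - v| ^+ 2 = `|u| ^+ 2 - 2 * ip u v + `|v| ^+ 2.
Proof. by rewrite !ipE ipBl !ipBr (ipC v u); ring. Qed.

(** Cauchy-Schwarz, from the expansion of the squared norm of
    [`|v| *: u - `|u| *: v]. *)
Lemma ip_le_norm u v : ip u v <= `|u| * `|v|.
Proof.
have [->|u0] := eqVneq u 0; first by rewrite ip0l normr0 mul0r.
have [->|v0] := eqVneq v 0; first by rewrite ip0r normr0 mulr0.
have up : 0 < `|u| by rewrite normr_gt0.
have vp : 0 < `|v| by rewrite normr_gt0.
have := sqr_ge0 (`| `|v| *: u - `|u| *: v |).
rewrite normB_sqr !normrZ !normr_id ipZl ipZr => h.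
have : 0 <= (`|u| * `|v|) * (`|u| * `|v| - ip u v) by lra.
by rewrite pmulr_rge0 ?mulr_gt0// subr_ge0.
Qed.

Lemma normr_ip_le u v : `|ip u v| <= `|u| * `|v|.
Proof.
rewrite ler_norml ip_le_norm andbT lerNl -ipNl.
by apply: (le_trans (ip_le_norm _ _)); rewrite normrN.
Qed.

Lemma cvg_ip T (F : set_system T) (FF : Filter F) (f g : T -> H) a b :
  f x @[x --> F] --> a -> g x @[x --> F] --> b ->
  ip (f x) (g x) @[x --> F] --> ip a b.
Proof.
move=> fa gb.
have -> : (fun x => ip (f x) (g x)) =
   (fun x => ip (f x - a) (g x - b) + ip a (g x - b) + ip (f x - a) b + ip a b).
  by apply/funext => x; rewrite !ipBl !ipBr; ring.
have nf : `|f x - a| @[x --> F] --> (0 : R).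
  by rewrite -(normr0 H) -(subrr a); apply: cvg_norm; apply: cvgB => //; exact: cvg_cst.
have ng : `|g x - b| @[x --> F] --> (0 : R).
  by rewrite -(normr0 H) -(subrr b); apply: cvg_norm; apply: cvgB => //; exact: cvg_cst.
have small (h : T -> R) (k : T -> R) : (forall x, `|h x| <= k x) ->
    k x @[x --> F] --> (0 : R) -> h x @[x --> F] --> (0 : R).
  move=> hk k0; apply: norm_cvg0; apply: (squeeze_cvgr _ (cvg_cst 0) k0).
  by apply: nearW => x; rewrite normr_ge0 hk.
rewrite -[X in _ --> X]add0r; apply: cvgD; last exact: cvg_cst.
rewrite -[X in _ --> X](addr0 0); apply: cvgD.
  rewrite -[X in _ --> X](addr0 0); apply: cvgD.
    apply: (small _ (fun x => `|f x - a| * `|g x - b|)) => [x|].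
      exact: normr_ip_le.
    by rewrite -(mulr0 0); exact: cvgM.
  apply: (small _ (fun x => `|a| * `|g x - b|)) => [x|].
    exact: normr_ip_le.
  by rewrite -(mulr0 `|a|); apply: cvgM => //; exact: cvg_cst.
apply: (small _ (fun x => `|f x - a| * `|b|)) => [x|].
  exact: normr_ip_le.
by rewrite -(mul0r `|b|); apply: cvgM => //; exact: cvg_cst.
Qed.

Lemma is_derive_normr_sqr (f : R -> H) (df : H) (t : R) :
  is_derive t 1 f df ->
  is_derive t 1 (fun s => `|f s| ^+ 2) (2 * ip (f t) df).
Proof.
move=> [dv dfE].
have cf : f (h + t) @[h --> 0^'] --> f t.
  have ct : {for t, continuous f}.
    by apply/differentiable_continuous/derivable1_diffP.
  have sh : h + t @[h --> (0 : R)] --> t.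
    rewrite -[X in _ --> X](add0r t).
    by apply: cvgD; [exact: cvg_id | exact: cvg_cst].
  have c0 : f (h + t) @[h --> (0 : R)] --> f t by exact: (cvg_comp _ _ sh ct).
  exact: (cvg_trans (cvg_app _ (@nbhs_dnbhs _ (0 : R))) c0).
have q : (h^-1 *: (f (h *: 1 + t) - f t)) @[h --> 0^'] --> df.
  by rewrite -dfE; exact: dv.
have lim : h^-1 *: (((fun s => `|f s| ^+ 2) (h *: 1 + t)) - `|f t| ^+ 2)
    @[h --> 0^'] --> 2 * ip (f t) df.
  have -> : 2 * ip (f t) df = ip df (f t) + ip (f t) df.
    by rewrite (ipC df); ring.
  under eq_fun => h.
    have -> : h^-1 *: (`|f (h *: 1 + t)| ^+ 2 - `|f t| ^+ 2) =
      ip (h^-1 *: (f (h *: 1 + t) - f t)) (f (h *: 1 + t))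
      + ip (f t) (h^-1 *: (f (h *: 1 + t) - f t)).
      rewrite ipZl ipZr !ipBl !ipBr !ipE (ipC (f t)) /GRing.scale /=; ring.
    over.
  apply: cvgD; apply: cvg_ip => //; last exact: cvg_cst.
  have -> : (fun h : R => f (h *: 1 + t)) = (fun h => f (h + t)).
    by apply/funext => h; rewrite [_%:A]mulr1.
  exact: cf.
split; first exact: (cvgP _ lim).
exact: cvg_lim lim.
Qed.

End InnerProduct.

(** One-sided mean value inequality for real functions. *)
Lemma derive_le_increment (R : realType) (f df : R -> R) (a b K : R) :
  a <= b -> (forall t, a <= t <= b -> is_derive t 1 f (df t)) ->
  (forall t, a <= t <= b -> df t <= K) -> f b - f a <= K * (b - a).
Proof.
move=> ab fd dK.
have [||c] := MVT_segment ab (df := df) (f := f).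
- by move=> t; rewrite in_itv /= => /andP[at_ tb]; apply: fd; rewrite !ltW.
- apply: derivable_within_continuous => t; rewrite in_itv /= => /fd h.
  exact: ex_derive.
- rewrite in_itv /= => /dK h ->.
  by rewrite ler_wpM2r// subr_ge0.
Qed.

(** * Nested closed convex sets and zeros of monotone operators *)

Section NestedConvex.
Context (R : realType) (H : completeNormedModType R) (ip : {dot H for idfun}).
Hypothesis ipE : norm_induced_by ip.

(** The parallelogram law bounds a distance by the norms of the endpoints and a
    lower bound for the norm of their midpoint. *)
Lemma parallelogram_mid (u v : H) (d : R) : 0 <= d ->
  d <= `|2^-1 *: (u + v)| ->
  `|u - v| ^+ 2 <= 2 * `|u| ^+ 2 + 2 * `|v| ^+ 2 - 4 * d ^+ 2.
Proof.
move=> d0; rewrite normrZ gtr0_norm ?invr_gt0// => dle.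
have : d ^+ 2 <= (2^-1 * `|u + v|) ^+ 2 by rewrite lerXn2r// nnegrE (le_trans d0).
rewrite exprMn (normD_sqr ipE) (normB_sqr ipE).
by lra.
Qed.

(** A decreasing sequence of closed midpoint-convex sets, all meeting a fixed
    ball, has a common point of least norm.  Near-minimizers of the norm in
    [C n] form a Cauchy sequence.  The constant sequence gives the existence of
    a point of least norm in a closed convex set; the general case replaces weak
    compactness of balls. *)
Lemma nested_convex_min_norm (C : nat -> set H) (B : R) :
  (forall n, closed (C n)) ->
  (forall n u v, C n u -> C n v -> C n (2^-1 *: (u + v))) ->
  (forall n m, (n <= m)%N -> C m `<=` C n) ->
  (forall n, exists2 u, C n u & `|u| <= B) ->
  exists2 z, (forall n, C n z) & forall w, (forall n, C n w) -> `|z| <= `|w|.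
Proof.
move=> clC midC decC bndC.
pose S n := [set `|u| | u in C n].
pose d n := inf (S n).
have lbS n : has_inf (S n).
  split; first by have [u Cu _] := bndC n; exists `|u|, u.
  by exists 0 => _ [u _ <-].
have d_le n u : C n u -> d n <= `|u|.
  by move=> Cu; apply: (ge_inf (lbS n).2); exists u.
have d_ge0 n : 0 <= d n by apply: (lb_le_inf (lbS n).1) => _ [u _ <-].
have d_incr : nondecreasing_seq d.
  move=> n m nm; apply: (lb_le_inf (lbS m).1) => _ [u Cu <-].
  exact/d_le/(decC n m).
have d_leB n : d n <= B by have [u Cu uB] := bndC n; exact: le_trans (d_le n u Cu) uB.
have d_cvg : d @ \oo --> limn d.
  by apply: nondecreasing_is_cvgn => //; exists B => _ [n _ <-].
set l := limn d in d_cvg.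
have d_lel n : d n <= l.
  by apply: nondecreasing_cvgn_le => //; exact: (cvgP _ d_cvg).
have /choice[z zP] n : exists u, C n u /\ `|u| < d n + n.+1%:R^-1.
  have [|_ [u Cu <-] uS] := @inf_adherent _ (S n) (n.+1%:R^-1) _ (lbS n).
    by rewrite invr_gt0.
  by exists u.
have zz n m : (n <= m)%N ->
    `|z n - z m| ^+ 2 <= 4 * (l + n.+1%:R^-1) ^+ 2 - 4 * d n ^+ 2.
  move=> nm.
  have zl k : (n <= k)%N -> `|z k| ^+ 2 <= (l + n.+1%:R^-1) ^+ 2.
    move=> nk; rewrite lerXn2r ?nnegrE//.
      by rewrite addr_ge0 ?invr_ge0// (le_trans (d_ge0 n)).
    apply: (le_trans (ltW (zP k).2)); apply: lerD => //.
    by rewrite lef_pV2 ?posrE// ler_nat ltnS.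
  have Cm : C n (2^-1 *: (z n + z m)).
    by apply: midC; [exact: (zP n).1 | exact: (decC n m nm _ (zP m).1)].
  (* Both norms are at most [l + n.+1%:R^-1], and the midpoint lies in [C n]. *)
  have arith (a b L D : R) : a <= L -> b <= L ->
      2 * a + 2 * b - 4 * D <= 4 * L - 4 * D by lra.
  apply: (le_trans (parallelogram_mid (d_ge0 n) (d_le _ _ Cm))).
  exact: arith (zl n (leqnn n)) (zl m nm).
have E0 : (4 * (l + n.+1%:R^-1) ^+ 2 - 4 * d n ^+ 2) @[n --> \oo] --> (0 : R).
  have -> : (0 : R) = 4 * ((l + 0) * (l + 0)) - 4 * (l * l) by ring.
  have h0 : n.+1%:R^-1 @[n --> \oo] --> (0 : R) by exact: cvg_harmonic.
  apply: cvgB; apply: cvgM; try exact: cvg_cst.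
    by apply: cvgM; apply: cvgD => //; exact: cvg_cst.
  exact: cvgM.
have zcvg : cvg (z @ \oo).
  apply/cauchy_cvgP/cauchy_exP => e e0.
  have e20 : 0 < e ^+ 2 by rewrite exprn_gt0.
  have [N _ EN] : \forall n \near \oo,
      4 * (l + n.+1%:R^-1) ^+ 2 - 4 * d n ^+ 2 < e ^+ 2.
    by move/cvgr_lt : E0; exact.
  exists (z N); exists N => // m /= Nm.
  rewrite -ball_normE /= -(ltr_pXn2r (n := 2))// ?nnegrE ?(ltW e0)//.
  exact: le_lt_trans (zz _ _ Nm) (EN N (leqnn N)).
exists (lim (z @ \oo)).
  move=> n; apply: (closed_cvg _ (clC n) _ _ zcvg).
  by exists n => // k /= nk; exact: (decC n k nk _ (zP k).1).
move=> w Cw.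
have nz : `|z n| @[n --> \oo] --> `|lim (z @ \oo)| by exact: cvg_norm.
have bz : d n + n.+1%:R^-1 @[n --> \oo] --> l + 0.
  by apply: cvgD => //; exact: cvg_harmonic.
rewrite addr0 in bz.
apply: (@le_trans _ _ l).
  apply: (ler_cvg_to nz bz).
  by apply: nearW => n; exact: ltW (zP n).2.
apply: (ler_cvg_to d_cvg (cvg_cst `|w|)).
by apply: nearW => n; exact: d_le.
Qed.

End NestedConvex.

Section Minty.
Context (R : realType) (H : normedModType R) (ip : {dot H for idfun}).
Hypothesis ipE : norm_induced_by ip.
Variable M : H -> H.
Hypothesis Mmono : monotone_operator ip M.

Lemma Zer_monotone z y : Zer M z -> ip (M y) (z - y) <= 0.
Proof.
move=> Mz; have := Mmono y z; rewrite Mz subr0.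
by rewrite -[y - z]opprB ipNr oppr_ge0.
Qed.

(** Minty's argument: test the inequality at [y = z - s *: M z] and let [s]
    tend to 0 from the right. *)
Lemma Minty_Zer z : continuous M ->
  (forall y, ip (M y) (z - y) <= 0) -> Zer M z.
Proof.
move=> Mc hz; rewrite /Zer /=; set w := M z.
have cM : M (z - s *: w) @[s --> 0^'+] --> w.
  have h : z - s *: w @[s --> (0 : R)^'+] --> z.
    rewrite -[X in _ --> X]subr0 -(scale0r w).
    apply: cvgB; first exact: cvg_cst.
    apply: cvgZr_tmp; exact: cvg_within.
  exact: (cvg_comp _ _ h (Mc z)).
have := cvg_ip ipE _ cM (cvg_cst w) => /(_ _) lim.
have : ip w w <= 0.
  apply: (ler_cvg_to (lim _) (cvg_cst 0)).
  near=> s.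
  have s0 : 0 < s by near: s; exact: nbhs_right_gt.
  have := hz (z - s *: w).
  by rewrite subKr ipZr pmulr_rle0.
rewrite -ipE => h; apply/eqP; rewrite -normr_eq0 -sqrf_eq0.
by rewrite eq_le h sqr_ge0.
Unshelve. all: by end_near. Qed.

End Minty.

Lemma closed_ip_le (R : realType) (H : normedModType R) (ip : {dot H for idfun})
    (ipE : norm_induced_by ip) (w c : H) (b : R) :
  closed [set z | ip w (z - c) <= b].
Proof.
apply: (@closed_comp _ _ (fun z => ip w (z - c)) [set r | r <= b]).
  move=> z _; apply: (cvg_ip ipE); first exact: cvg_cst.
  by apply: cvgB; [exact: cvg_id | exact: cvg_cst].
exact: closed_le.
Qed.

Lemma midpoint_ip_le (R : realType) (H : normedModType R)
    (ip : {dot H for idfun}) (w c u v : H) (b : R) :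
  ip w (u - c) <= b -> ip w (v - c) <= b ->
  ip w (2^-1 *: (u + v) - c) <= b.
Proof. by rewrite !ipBr ipZr ipDr; lra. Qed.

Section MinNormZero.
Context (R : realType) (H : completeNormedModType R) (ip : {dot H for idfun}).
Hypothesis ipE : norm_induced_by ip.
Variable M : H -> H.
Hypothesis Mmono : monotone_operator ip M.
Hypothesis Mc : continuous M.

Lemma Zer_min_norm : Zer M !=set0 ->
  exists2 xi, Zer M xi & forall z, Zer M z -> `|xi| <= `|z|.
Proof.
move=> [p Zp].
pose C (n : nat) := [set z : H | forall y, ip (M y) (z - y) <= 0].
have CZ z : Zer M z -> forall n, C n z by move=> Mz n y; exact: Zer_monotone.
have [||||xi xiC ximin] := nested_convex_min_norm ipE (C := C) (B := `|p|).
- move=> n.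
  have -> : C n = \bigcap_y [set z | ip (M y) (z - y) <= 0].
    by apply/seteqP; split => z h y; [move=> _; exact: h | exact: (h y I)].
  by apply: closed_bigI => y _; exact: closed_ip_le.
- by move=> n u v Cu Cv y; apply: midpoint_ip_le.
- by move=> n m _ z.
- by move=> n; exists p => //; exact: CZ.
- exists xi; first by apply: (Minty_Zer ipE Mc); exact: (xiC 0%N).
  by move=> z /CZ; exact: ximin.
Qed.

(** The variational inequality for the projection of 0 onto the convex set
    [Zer M], convexity being provided by [Minty_Zer]. *)
Lemma min_norm_zer_variational xi z : Zer M xi ->
  (forall z, Zer M z -> `|xi| <= `|z|) -> Zer M z -> ip xi (xi - z) <= 0.
Proof.
move=> Zxi ximin Zz; rewrite leNgt; apply/negP => a0.
set a := ip xi (xi - z) in a0; set b := `|z - xi| ^+ 2.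
have b0 : 0 <= b by exact: sqr_ge0.
(* With this [s], the decrease [2 * s * a] of the squared norm along the segment
   from [xi] to [z] exceeds the quadratic term [s ^+ 2 * b]. *)
pose s := a / (a + b).
have ab0 : 0 < a + b by lra.
have s0 : 0 < s by rewrite divr_gt0.
have s1 : s <= 1 by rewrite ler_pdivrMr// mul1r lerDl.
have Zs : Zer M (xi + s *: (z - xi)).
  apply: (Minty_Zer ipE Mc) => y.
  have := Zer_monotone Mmono y Zxi; have := Zer_monotone Mmono y Zz.
  rewrite !ipBr ipDr ipZr ipBr.
  move: (ip (M y) z) (ip (M y) xi) (ip (M y) y) => p q r; nra.
have : `|xi| ^+ 2 <= `|xi + s *: (z - xi)| ^+ 2.
  by rewrite lerXn2r ?nnegrE//; exact: ximin.
rewrite (normD_sqr ipE) normrZ exprMn gtr0_norm// -/b ipZr.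
have -> : ip xi (z - xi) = - a by rewrite -ipNr opprB.
have : s * (a + b) = a by rewrite divfK// gt_eqF.
move: (`|xi| ^+ 2) => c.
nra.
Qed.

Lemma metric_projection_Zer xi : Zer M xi ->
  (forall z, Zer M z -> `|xi| <= `|z|) ->
  metric_projection (Zer M) 0 = [set xi].
Proof.
move=> Zxi ximin; apply/seteqP; split => [z [Zz zmin]|_ ->]; last first.
  by split => // q Zq; rewrite !sub0r !normrN; exact: ximin.
have zxi : `|z| <= `|xi| by have := zmin _ Zxi; rewrite !sub0r !normrN.
have v : ip xi (xi - z) <= 0 by exact: min_norm_zer_variational.
apply/eqP; rewrite -subr_eq0 -normr_eq0 -sqrf_eq0 eq_le sqr_ge0 andbT.
have : `|z| ^+ 2 <= `|xi| ^+ 2 by rewrite lerXn2r ?nnegrE.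
move: v; rewrite (normB_sqr ipE) ipBr -(ipE xi) (ipC ip z).
by move: (`|z| ^+ 2) (`|xi| ^+ 2) => a b; lra.
Qed.

End MinNormZero.

(** * Induction on intervals, derivatives and absolute continuity *)

(** Cousin's lemma as an induction principle: a property of intervals that is
    stable under concatenation, and holds for all small intervals around each
    point, holds for the whole interval. *)
Lemma interval_cousin (R : realType) (P : R -> R -> Prop) (a b : R) :
  a <= b ->
  (forall u v w, u <= v -> v <= w -> P u v -> P v w -> P u w) ->
  (forall c, a <= c -> c <= b -> exists2 d, 0 < d &
     forall u v, a <= u -> c - d < u -> u <= c -> c <= v -> v < c + d ->
       v <= b -> P u v) ->
  P a b.
Proof.
move=> ab Ptrans Ploc.
pose S := [set c | [/\ a <= c, c <= b & P a c]].
have Sa : S a.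
  split => //; have [d d0 h] := Ploc a (lexx a) ab.
  by apply: h; rewrite ?lexx// ?ltrDl// ltrBlDr ltrDl.
have Ssup : has_sup S by split; [exists a | exists b => c []].
set s := sup S.
have as_ : a <= s by apply: (ub_le_sup Ssup.2).
have sb : s <= b by apply: (ge_sup Ssup.1) => c [].
have [d d0 hd] := Ploc s as_ sb.
have [c [ac cb Pac] sc] := sup_adherent d0 Ssup.
have cs : c <= s by exact: (ub_le_sup Ssup.2).
pose v := Num.min b (s + d / 2).
have d20 : 0 < d / 2 by rewrite divr_gt0.
have sv : s <= v by rewrite le_min sb lerDl ltW.
have vb : v <= b by rewrite ge_min lexx.
have Pcv : P c v.
  apply: hd => //; rewrite gt_min; apply/orP; right.
  by rewrite ltrD2l ltr_pdivrMr// ltr_pMr// ltr1n.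
have Pav : P a v by apply: (Ptrans _ c) => //; exact: le_trans cs sv.
have vs : v <= s by apply: (ub_le_sup Ssup.2); split => //; exact: le_trans as_ sv.
have : v = b.
  by move: vs; rewrite /v; case: (leP b (s + d / 2)) => // _; rewrite gerDl leNgt d20.
by move=> <-.
Qed.

(** The epsilon-delta form of differentiability, in both directions. *)
Lemma is_derive_linear_approx (R : realType) (H : normedModType R)
    (f : R -> H) (c : R) (df : H) :
  is_derive c 1 f df <->
  forall e, 0 < e -> exists2 d, 0 < d & forall s, `|s - c| < d ->
    `|f s - f c - (s - c) *: df| <= e * `|s - c|.
Proof.
have quot (h : R) : h != 0 ->
    `|h^-1 *: (f (h *: 1 + c) - f c) - df| =
    `|h|^-1 * `|f (h + c) - f c - h *: df|.
  move=> h0; rewrite [_%:A]mulr1 -normfV -normrZ [in RHS]scalerBr.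
  by rewrite [h^-1 *: (h *: _)]scalerA mulVf// scale1r.
split => [[dv dfE] e e0|hyp].
  have : h^-1 *: (f (h *: 1 + c) - f c) @[h --> 0^'] --> df.
    by rewrite -dfE; exact: dv.
  move/cvgrPdist_le => /(_ e e0); rewrite near_withinE /= => -[d /= d0 hd].
  exists d => // s sc.
  have [->|sc0] := eqVneq s c; first by rewrite !subrr scale0r subrr !normr0 mulr0.
  have h0 : s - c != 0 by rewrite subr_eq0.
  have := hd (s - c); rewrite /ball /= sub0r normrN => /(_ sc h0).
  rewrite distrC quot// subrK ler_pdivrMl ?normr_gt0//.
  by rewrite mulrC.
have lim : h^-1 *: (f (h *: 1 + c) - f c) @[h --> 0^'] --> df.
  apply/cvgrPdist_le => e e0; have [d d0 hd] := hyp e e0.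
  rewrite near_withinE /=; exists d => //= h; rewrite /ball /= sub0r normrN => hd' h0.
  rewrite distrC quot// ler_pdivrMl ?normr_gt0//.
  by have := hd (h + c); rewrite addrK mulrC; apply.
by split; [exact: (cvgP _ lim) | exact: cvg_lim lim].
Qed.

(** Mean value inequality for an absolutely continuous function whose derivative
    is almost everywhere within [K] of [w].  The exceptional null set is covered
    by an open set [U] of small measure; on small intervals around a point of
    differentiability the increment is controlled by the derivative, and
    intervals around an exceptional point lie in [U], where absolute continuity
    bounds their total contribution. *)
Lemma ac_mean_value (R : realType) (H : normedModType R) (a b : R)
    (f : R -> H) (w : H) (K : R) :
  a <= b -> 0 <= K -> absolutely_continuous_on a b f ->
  {ae lebesgue_measure, forall t : R, a < t -> t < b ->
     derivable f t 1 /\ `|derive1 f t - w| <= K} ->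
  `|f b - f a - (b - a) *: w| <= K * (b - a).
Proof.
move=> ab K0 fac [N [mN N0 Nsub]].
have main e : 0 < e ->
    `|f b - f a - (b - a) *: w| <= (K + e) * (b - a) + 2 * e.
  move=> e0; have [d d0 hd] := fac e e0.
  (* The endpoints, where no derivative is assumed, join the exceptional set. *)
  pose D := N `|` [set a; b].
  have w1 : 0 < `|w| + 1 by rewrite ltr_wpDl.
  (* Smaller than [d] for absolute continuity; the second bound controls the
     contribution of [w] over the exceptional intervals. *)
  pose r := Num.min d (e / (`|w| + 1)).
  have r0 : 0 < r by rewrite lt_min d0 divr_gt0.
  have [U [oU DU muU]] : exists U : set R,
      [/\ open U, D `<=` U & (lebesgue_measure U < r%:E)%E].
    have mab : measurable [set a; b].
      by apply: measurableU; exact: measurable_set1.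
    have mD : measurable D by exact: measurableU.
    have D0 : lebesgue_measure D = 0%E.
      have ab0 : lebesgue_measure [set a; b] = 0%E.
        rewrite measureU0; [exact: lebesgue_measure_set1|..];
          [exact: measurable_set1 | exact: measurable_set1 |].
        exact: lebesgue_measure_set1.
      by rewrite measureU0.
    have [|U [oU DU UD]] := lebesgue_regularity_outer mD _ r0.
      by rewrite [X in (X < _)%E]D0.
    exists U; split => //.
    have -> : U = D `|` (U `\` D) by rewrite (setDUK DU).
    apply: (le_lt_trans (measureU2 _ mD _)).
      by apply: measurableD => //; exact: open_measurable.
    by rewrite [X in (X + _)%E]D0 add0e.
  (* The increment over [u, v] exceeds its bound by at most the contribution of
     finitely many disjoint subintervals contained in [U]. *)
  pose P u v := exists n (s t : 'I_n -> R),
    [/\ forall i, [/\ u <= s i, s i <= t i & t i <= v],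
        trivIset setT (fun i => [set` `]s i, t i[]),
        forall i, [set` `]s i, t i[] `<=` U &
        `|f v - f u - (v - u) *: w| <= (K + e) * (v - u) +
          \sum_(i < n) (`|f (t i) - f (s i)| + `|w| * (t i - s i))].
  suff : P a b.
    move=> [n [s [t [abst tri stU fab]]]].
    have len : \sum_(i < n) (t i - s i) < r.
      rewrite -lte_fin; apply: le_lt_trans muU.
      have -> : (\sum_(i < n) (t i - s i))%:E =
          lebesgue_measure (\big[setU/set0]_(i < n) `]s i, t i[%classic).
        rewrite measure_bigsetU_ord//= -sumEFin; apply: eq_bigr => i _.
        rewrite lebesgue_measure_itv /= lte_fin.
        have [_ + _] := abst i; rewrite le_eqVlt => /orP[/eqP ->|->//].
        by rewrite ltxx subrr.
      apply: le_measure; rewrite ?inE.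
      - by apply: bigsetU_measurable => i _; exact: measurable_itv.
      - exact: open_measurable.
      - apply: (big_ind (fun A => A `<=` U)) => [|A B AU BU|i _]; last exact: stU.
          exact: sub0set.
        by rewrite subUset.
    apply: (le_trans fab); rewrite lerD2l big_split /= -mulr_sumr.
    have -> : 2 * e = e + e by ring.
    apply: lerD.
      apply: ltW; apply: hd => //; first by move=> i; have [? ? ?] := abst i.
      by apply: (lt_le_trans len); rewrite ge_min lexx.
    have lenw : \sum_(i < n) (t i - s i) <= e / (`|w| + 1).
      by apply: (le_trans (ltW len)); rewrite ge_min lexx orbT.
    apply: (@le_trans _ _ (`|w| * (e / (`|w| + 1)))); first by rewrite ler_wpM2l.
    by rewrite mulrA ler_pdivrMr// mulrC ler_pM2l// lerDl.
  apply: interval_cousin => //.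
    move=> u v x uv vx [n [s [t [hst tri stU fuv]]]] [m [s' [t' [hst' tri' stU' fvx]]]].
    exists (n + m)%N.
    exists (fun i : 'I_(n + m) =>
      match fintype.split i with inl j => s j | inr j => s' j end).
    exists (fun i : 'I_(n + m) =>
      match fintype.split i with inl j => t j | inr j => t' j end).
    split.
    - move=> i; case: (fintype.split i) => j.
        by have [h1 h2 h3] := hst j; split => //; exact: le_trans h3 vx.
      by have [h1 h2 h3] := hst' j; split => //; exact: le_trans uv h1.
    - have cross i j : [set` `]s i, t i[] `&` [set` `]s' j, t' j[] = set0.
        have [_ _ h1] := hst i; have [h2 _ _] := hst' j.
        apply/seteqP; split => // y /= [].
        by rewrite !in_itv /= => /andP[_ y1] /andP[y2 _]; lra.
      move=> i j _ _.
      case: (fintype.split_ordP i) => i' ->; case: (fintype.split_ordP j) => j' ->;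
        rewrite ?(fintype.unsplitK (inl i')) ?(fintype.unsplitK (inr i'))
          ?(fintype.unsplitK (inl j')) ?(fintype.unsplitK (inr j')) => -[y [y1 y2]].
      + by rewrite (tri i' j')//; exists y.
      + by have := cross i' j'; move/seteqP => [/(_ y)]; case.
      + by have := cross j' i'; move/seteqP => [/(_ y)]; case.
      + by rewrite (tri' i' j')//; exists y.
    - by move=> i; case: (fintype.split i) => j; [exact: stU | exact: stU'].
    - rewrite big_split_ord /=.
      under eq_bigr do rewrite (fintype.unsplitK (inl _)).
      under [X in _ <= _ + (_ + X)]eq_bigr do rewrite (fintype.unsplitK (inr _)).
      have -> : f x - f u - (x - u) *: w =
          (f v - f u - (v - u) *: w) + (f x - f v - (x - v) *: w).
        rewrite [(x - u)](_ : _ = (v - u) + (x - v)); last by ring.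
        rewrite scalerDl opprD [RHS]addrACA; congr (_ + _).
        by rewrite [RHS]addrC addrA subrK.
      apply: (le_trans (ler_normD _ _)).
      apply: (le_trans (lerD fuv fvx)).
      by rewrite addrACA -mulrDr lerD2r; have -> : v - u + (x - v) = x - u by ring.
  move=> c ac cb.
  have [Dc|nDc] := pselect (D c).
    have [d' /= d'0 hd'] : nbhs c U by apply: open_nbhs_nbhs; split => //; exact: DU.
    exists d' => // u v au ud uc cv vd vb.
    exists 1%N, (fun=> u), (fun=> v); split => //.
    - by split => //; exact: le_trans uc cv.
    - by move=> i j _ _; rewrite !ord1.
    - move=> _ y /=; rewrite in_itv /= => /andP[uy yv].
      apply: hd'; rewrite /ball /= ltr_norml.
      by apply/andP; split; lra.
    - rewrite big_ord1.
      apply: (le_trans (ler_normB _ _)); rewrite normrZ ger0_norm ?subr_ge0 ?(le_trans uc)//.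
      rewrite [_ * `|w|]mulrC lerDr mulr_ge0 ?subr_ge0 ?(le_trans uc)//.
      by rewrite addr_ge0// ltW.
  have nNc : ~ N c by move=> Nc; apply: nDc; left.
  have ac' : a < c.
    by rewrite lt_neqAle ac andbT; apply/eqP => E; apply: nDc; right; left.
  have cb' : c < b.
    by rewrite lt_neqAle cb andbT; apply/eqP => E; apply: nDc; right; right.
  have [dv dw] : derivable f c 1 /\ `|derive1 f c - w| <= K.
    by apply: contrapT => h; apply: nNc; apply: Nsub => /= h'; apply: h; exact: h'.
  have : is_derive c 1 f (derive1 f c) by rewrite derive1E; exact: derivableP.
  move/is_derive_linear_approx => /(_ e e0)[d' d'0 happ].
  exists d' => // u v au ud uc cv vd vb.
  exists 0%N, (fun=> 0), (fun=> 0); split; try by case.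
  rewrite big_ord0 addr0.
  have Hu := happ u; have Hv := happ v.
  rewrite ler0_norm ?subr_le0// ltrNl in Hu; rewrite ger0_norm ?subr_ge0// in Hv.
  have {}Hu := Hu ltac:(lra); have {}Hv := Hv ltac:(lra).
  have -> : f v - f u - (v - u) *: w = (f v - f c - (v - c) *: derive1 f c)
      - (f u - f c - (u - c) *: derive1 f c) + (v - u) *: (derive1 f c - w).
    have alg (A B C p q z : H) :
        A - B - z = (A - C - p) - (B - C - q) + (p - q - z).
      rewrite addrA; congr (_ - _); rewrite !opprD !opprK.
      rewrite [_ - p + _]addrACA [- B + C]addrC [A - C + _]addrA subrK -addrA.
      by rewrite [- p + q]addrC subrKA subrr addr0.
    rewrite scalerBr (_ : (v - u) *: derive1 f c =
      (v - c) *: derive1 f c - (u - c) *: derive1 f c); first exact: alg.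
    by rewrite -scalerBl; congr (_ *: _); ring.
  apply: (le_trans (ler_normD _ _)).
  rewrite normrZ ger0_norm ?subr_ge0 ?(le_trans uc)//.
  have h3 : (v - u) * `|derive1 f c - w| <= (v - u) * K.
    by rewrite ler_wpM2l// subr_ge0 (le_trans uc).
  have h4 := ler_normB (f v - f c - (v - c) *: derive1 f c)
    (f u - f c - (u - c) *: derive1 f c).
  lra.
apply/ler_addgt0Pr => e e0.
have q0 : 0 < b - a + 2 by lra.
have := main (e / (b - a + 2)); rewrite divr_gt0// => /(_ isT).
have : e / (b - a + 2) * (b - a + 2) = e by rewrite divfK// gt_eqF.
move: (e / (b - a + 2)) => e' ee'; lra.
Qed.

Lemma ac_subinterval (R : realType) (H : normedModType R) (a b c d : R)
    (f : R -> H) : a <= c -> d <= b ->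
  absolutely_continuous_on a b f -> absolutely_continuous_on c d f.
Proof.
move=> ac db fac e e0; have [r r0 hr] := fac e e0; exists r => // n s t hst.
apply: hr => i; have [h1 [h2 h3]] := hst i.
by split; [exact: le_trans h1 | split => //; exact: le_trans h3 db].
Qed.

Lemma ac_continuous (R : realType) (H : normedModType R) (a b c : R)
    (f : R -> H) : a < c -> c < b ->
  absolutely_continuous_on a b f -> {for c, continuous f}.
Proof.
move=> ac cb fac; apply/cvgrPdist_lt => e e0; have [d d0 hd] := fac e e0.
have step u v : a <= u -> u <= v -> v <= b -> v - u < d -> `|f v - f u| < e.
  move=> au uv vb uvd.
  have := hd 1%N (fun=> u) (fun=> v); rewrite !big_ord1; apply => //.
  by move=> i j _ _; rewrite !ord1.
near=> s.
have sd : `|s - c| < d.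
  near: s; exists d => // s; rewrite /ball /= distrC; exact.
have sa : a < s by near: s; exact: lt_nbhsr.
have sb : s < b by near: s; exact: lt_nbhsl.
have [sc|cs] := leP s c.
  apply: step; [exact: ltW | by [] | exact: ltW |].
  by move: sd; rewrite distrC ger0_norm// subr_ge0.
rewrite distrC; apply: step; [exact: ltW | exact: ltW | exact: ltW |].
by move: sd; rewrite ger0_norm// subr_ge0 ltW.
Unshelve. all: by end_near. Qed.

(** * Differentiability of the trajectory *)

Section Trajectory.
Context (R : realType) (H : completeNormedModType R) (ip : {dot H for idfun}).
Hypothesis ipE : norm_induced_by ip.
Variable M : H -> H.
Hypothesis Mmono : monotone_operator ip M.
Hypothesis Mc : continuous M.
Variables (t0 : R) (x0 : H) (x : R -> H).
Hypothesis t0_gt0 : 0 < t0.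
Hypothesis xsol : strong_global_solution M t0 x0 x.

(** The right-hand side of the equation along the trajectory; it is the
    derivative of [x] at every [t > t0], see [sol_is_derive]. *)
Definition velocity (s : R) : H := - M (x s) - s^-1 *: x s.

Lemma sol_continuous t : t0 < t -> {for t, continuous x}.
Proof.
move=> t0t; have [xac _ _ _] := xsol.
apply: (@ac_continuous _ _ t0 (t + 1)) => //; first by rewrite ltrDl.
by apply: xac; rewrite ltW// (lt_trans t0t)// ltrDl.
Qed.

Lemma velocity_continuous t : t0 < t -> {for t, continuous velocity}.
Proof.
move=> t0t; have t_gt0 : 0 < t by exact: lt_trans t0t.
apply: cvgB.
  apply: cvgN; apply: (@continuous_comp _ _ _ x M); last exact: Mc.
  exact: sol_continuous.
apply: cvgZ; last exact: sol_continuous.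
by apply: cvgV; [rewrite gt_eqF | exact: cvg_id].
Qed.

(** Strict differentiability: the increments of [x] are approximated by
    [velocity c] uniformly over all intervals near [c], not only those having
    [c] as an endpoint. *)
Lemma sol_strong_derive c e : t0 < c -> 0 < e ->
  exists2 d, 0 < d & forall u v, c - d < u -> u <= v -> v < c + d ->
    t0 < u /\ `|x v - x u - (v - u) *: velocity c| <= e * (v - u).
Proof.
move=> t0c e0; have [xac _ xae _] := xsol.
have [d1 /= d10 hd1] : \forall s \near c, `|velocity c - velocity s| <= e.
  by have /cvgrPdist_le := velocity_continuous t0c; exact.
pose d := Num.min d1 (c - t0).
have dd1 : d <= d1 by rewrite ge_min lexx.
have dt0 : d <= c - t0 by rewrite ge_min lexx orbT.
exists d; first by rewrite lt_min d10 subr_gt0.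
move=> u v cu uv vc.
have t0u : t0 < u by lra.
split => //; apply: ac_mean_value => //; first exact: ltW.
  apply: (@ac_subinterval _ _ t0 v) => //; first exact: ltW.
  by apply: xac; rewrite (le_trans (ltW t0u)).
have aeF : Filter (almost_everywhere (@lebesgue_measure R)).
  exact: ae_filter_ringOfSetsType.
apply: (@filterS _ _ aeF _ _ _ xae) => s hs us sv.
have [dxs xs] := hs (lt_trans t0u us); split => //.
have -> : derive1 x s = velocity s.
  by apply/eqP; rewrite /velocity -opprD -subr_eq0 opprK addrA xs.
rewrite distrC; apply: hd1; rewrite /ball /= ltr_norml; apply/andP; split; lra.
Qed.

Lemma sol_is_derive t : t0 < t -> is_derive t 1 x (velocity t).
Proof.
move=> t0t; apply/is_derive_linear_approx => e e0.
have [d d0 hd] := sol_strong_derive t0t e0; exists d => // s.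
rewrite ltr_norml => /andP[s1 s2].
have [st|ts] := leP s t.
  have [||_] := hd s t _ st; [lra | lra |].
  rewrite ler0_norm ?subr_le0// opprB => h.
  by rewrite -[x s - x t]opprB -[s - t]opprB scaleNr -opprD normrN.
have [||_] := hd t s _ (ltW ts); [lra | lra |].
by rewrite ger0_norm// subr_ge0 ltW.
Qed.

(** The difference quotients converge jointly in the base point and the step. *)
Lemma quotient_cvg c : t0 < c ->
  (p.2^-1 *: (x (p.1 + p.2) - x p.1)) @[p --> (nbhs c, (0 : R)^'+)] --> velocity c.
Proof.
move=> t0c; apply/cvgrPdist_le => e e0.
have [d d0 hd] := sol_strong_derive t0c e0.
have d20 : 0 < d / 2 by rewrite divr_gt0.
exists (ball c (d / 2), [set h | 0 < h /\ h < d / 2]); last first.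
  move=> [s h] /= []; rewrite /ball /= => sc [h0 h2].
  move: sc; rewrite ltr_norml => /andP[s1 s2].
  have dE : d = d / 2 + d / 2 by rewrite -splitr.
  have [| | |_] := hd s (s + h); [lra | lra | lra |].
  rewrite [s + h - s]addrAC subrr add0r => hh.
  rewrite distrC -[velocity c]scale1r -(mulVf (lt0r_neq0 h0)) -scalerA -scalerBr.
  by rewrite normrZ gtr0_norm ?invr_gt0// ler_pdivrMl// mulrC.
split => /=; first exact: nbhsx_ballx.
near=> h; split; first by near: h; exact: nbhs_right_gt.
by near: h; exact: nbhs_right_lt.
Unshelve. all: by end_near. Qed.

Lemma quotient_cvg_right c : t0 < c ->
  (h^-1 *: (x (c + h) - x c)) @[h --> (0 : R)^'+] --> velocity c.
Proof.
move=> t0c.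
have cp : (c, h) @[h --> (0 : R)^'+] --> (nbhs c, (0 : R)^'+).
  by apply: cvg_pair; [exact: cvg_cst | exact: cvg_id].
exact: (cvg_comp _ _ cp (quotient_cvg t0c)).
Qed.

End Trajectory.

(** * Energy estimates *)

Lemma is_derive_shiftr (R : realType) (H : normedModType R) (f : R -> H)
    (t h : R) (df : H) :
  is_derive (t + h) 1 f df -> is_derive t 1 (fun s => f (s + h)) df.
Proof.
move=> /is_derive_linear_approx fd; apply/is_derive_linear_approx => e e0.
have [d d0 hd] := fd e e0; exists d => // s sd.
have E : s + h - (t + h) = s - t by ring.
by have := hd (s + h); rewrite E; apply.
Qed.

Section Energy.
Context (R : realType) (H : completeNormedModType R) (ip : {dot H for idfun}).
Hypothesis ipE : norm_induced_by ip.
Variable M : H -> H.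
Hypothesis Mmono : monotone_operator ip M.
Hypothesis Mc : continuous M.
Variables (t0 : R) (x0 : H) (x : R -> H).
Hypothesis t0_gt0 : 0 < t0.
Hypothesis xsol : strong_global_solution M t0 x0 x.

Let g := velocity M x.
Let xD t (t0t : t0 < t) := sol_is_derive Mc t0_gt0 xsol t0t.

Lemma dist_zero_derive xi t : t0 < t ->
  is_derive t 1 (fun s => `|x s - xi| ^+ 2) (2 * ip (x t - xi) (g t)).
Proof.
move=> t0t; apply: is_derive_normr_sqr => //.
have := xD t0t => d; apply: is_derive_eq; exact: subr0.
Qed.

Lemma dist_zero_velocity xi t : t0 < t -> Zer M xi ->
  t * ip (x t - xi) (g t) <= - ip (x t) (x t - xi).
Proof.
move=> t0t Zxi; have t_gt0 : 0 < t by exact: lt_trans t0t.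
have h : 0 <= ip (M (x t)) (x t - xi).
  by rewrite -[x t - xi]opprB ipNr oppr_ge0; exact: Zer_monotone.
rewrite /g /velocity ipBr ipNr ipZr (ipC ip _ (M _)) (ipC ip _ (x t)).
move: (ip (x t) _) h; move: (ip _ _) => A B A0.
rewrite mulrBr mulVKf ?gt_eqF// lerBlDr addNr mulrN oppr_le0.
by rewrite pmulr_rge0.
Qed.

(** A Gronwall-type estimate: under the differential inequality in the
    hypothesis, the distance squared minus [c], weighted by a power of [t], is
    nonincreasing.  It serves with exponent 1 for boundedness and with exponent
    2 for strong convergence. *)
Lemma weighted_dist_decay (k : nat) (c : R) xi a b : t0 < a -> a <= b ->
  (forall t, a <= t -> t <= b ->
     2 * t * ip (x t - xi) (g t) <= - k.+1%:R * (`|x t - xi| ^+ 2 - c)) ->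
  b ^+ k.+1 * (`|x b - xi| ^+ 2 - c) <= a ^+ k.+1 * (`|x a - xi| ^+ 2 - c).
Proof.
move=> t0a ab hd; rewrite -subr_le0 -(mul0r (b - a)).
pose df t := t ^+ k.+1 * (2 * ip (x t - xi) (g t)) +
   (`|x t - xi| ^+ 2 - c) * (k.+1%:R * t ^+ k).
apply: (derive_le_increment (f := fun t => t ^+ k.+1 * (`|x t - xi| ^+ 2 - c))
  (df := df)) => //.
  move=> t /andP[at_ tb]; have t0t : t0 < t by exact: lt_le_trans at_.
  have d1 := dist_zero_derive xi t0t.
  have d2 : is_derive t 1 (fun s : R => s ^+ k.+1) (k.+1%:R * t ^+ k).
    have := is_deriveX k.+1 (is_derive_id t (1 : R)).
    by rewrite exprfctE [_ *: _]mulr1.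
  have d3 : is_derive t 1 (fun s => `|x s - xi| ^+ 2 - c)
      (2 * ip (x t - xi) (g t)).
    by apply: is_derive_eq; exact: subr0.
  exact: (is_deriveM d2 d3).
move=> t /andP[at_ tb]; rewrite /df exprS.
have t_ge0 : 0 <= t by rewrite ltW// (lt_trans t0_gt0)// (lt_le_trans t0a).
have := hd t at_ tb; have : 0 <= t ^+ k by exact: exprn_ge0.
move: (t ^+ k) (ip _ _) (`|_| ^+ 2 - c) => p q r; nra.
Qed.

Lemma sol_bounded a : Zer M !=set0 -> t0 < a ->
  exists2 B, 0 < B & forall t, a <= t -> `|x t| <= B.
Proof.
move=> [xi Zxi] t0a.
pose Q := `|xi| ^+ 2 + `|x a - xi| ^+ 2.
have Q0 : 0 <= Q by rewrite addr_ge0// sqr_ge0.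
exists (Q + 1 + `|xi|); first by rewrite ltr_pwDl// ltr_wpDl.
move=> t at_.
have a_gt0 : 0 < a by exact: lt_trans t0a.
have t_gt0 : 0 < t by exact: lt_le_trans at_.
have h : t * (`|x t - xi| ^+ 2 - `|xi| ^+ 2) <=
    a * (`|x a - xi| ^+ 2 - `|xi| ^+ 2).
  have := @weighted_dist_decay 0 (`|xi| ^+ 2) xi a t t0a at_.
  rewrite !expr1; apply => s as_ st.
  have t0s : t0 < s by exact: lt_le_trans as_.
  have := dist_zero_velocity t0s Zxi.
  rewrite (normB_sqr ipE) (ipBr ip (x s) xi) -(ipE (x s)).
  have := sqr_ge0 `|x s|.
  move: (ip _ (g s)) (`|x s| ^+ 2) (`|xi| ^+ 2) => A B C.
  by move: (ip (x s) xi) => D; lra.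
have hQ : `|x t - xi| ^+ 2 <= Q.
  rewrite /Q; move: h (sqr_ge0 `|x a - xi|) (sqr_ge0 `|xi|).
  move: (`|x t - xi| ^+ 2) (`|x a - xi| ^+ 2) (`|xi| ^+ 2) => A B C.
  have := at_; nra.
have hn : `|x t - xi| <= Q + 1.
  rewrite leNgt; apply/negP => hl.
  move: hQ hl; move: (`|x t - xi|) => A; nra.
rewrite -[x t](subrK xi); apply: (le_trans (ler_normD _ _)).
by rewrite lerD2r.
Qed.

(** The difference quotient of [x] at [s] with step [h]. *)
Definition quotient (h s : R) : H := h^-1 *: (x (s + h) - x s).

Lemma quotient_energy_derive h s : 0 < h -> t0 < s ->
  is_derive s 1 (fun r => r ^+ 2 * `|quotient h r| ^+ 2)
   (s ^+ 2 * (2 * ip (quotient h s) (h^-1 *: (g (s + h) - g s))) +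
    `|quotient h s| ^+ 2 * (2 * s)).
Proof.
move=> h0 t0s.
have t0sh : t0 < s + h by rewrite (lt_trans t0s)// ltrDl.
have d1 := is_derive_shiftr (xD t0sh).
have d2 := xD t0s.
have d3 : is_derive s 1 (quotient h) (h^-1 *: (g (s + h) - g s)).
  exact: is_deriveZ.
have d4 := is_derive_normr_sqr ipE d3.
have d5 : is_derive s 1 (fun r : R => r ^+ 2) (2 * s).
  have := is_deriveX 2 (is_derive_id s (1 : R)).
  by rewrite exprfctE expr1 [_ *: _]mulr1.
exact: (is_deriveM d5 d4).
Qed.

(** Discrete form of the energy inequality: monotonicity of [M] absorbs the
    increment of [M \o x], and the damping term cancels the derivative of the
    weight [s ^+ 2]. *)
Lemma quotient_energy_bound h s : 0 < h -> t0 < s ->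
  s ^+ 2 * (2 * ip (quotient h s) (h^-1 *: (g (s + h) - g s))) +
    `|quotient h s| ^+ 2 * (2 * s) <=
  2 * (s / (s + h) * ip (quotient h s) (x (s + h))).
Proof.
move=> h0 t0s; have s0 : 0 < s by exact: lt_trans t0s.
have sh0 : 0 < s + h by rewrite addr_gt0.
rewrite /g /velocity /quotient; set y := x (s + h); set z := x s;
  set w := h^-1 *: (y - z).
have mono : 0 <= ip w (h^-1 *: (M y - M z)).
  by rewrite /w ipZl ipZr (ipC ip) !mulr_ge0 ?invr_ge0 ?(ltW h0)//; exact: Mmono.
have -> : h^-1 *: (- M y - (s + h)^-1 *: y - (- M z - s^-1 *: z)) =
   - (h^-1 *: (M y - M z)) - s^-1 *: w + (s * (s + h))^-1 *: y.
  have E : (s + h)^-1 *: y = s^-1 *: y - (h / (s * (s + h))) *: y.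
    rewrite -scalerBl; congr (_ *: _); field.
    by rewrite !gt_eqF.
  have E2 : - M y - (s + h)^-1 *: y - (- M z - s^-1 *: z) =
     - (M y - M z) - s^-1 *: (y - z) + (h / (s * (s + h))) *: y.
    rewrite E scalerBr; move: (_ *: y) (_ *: y) (_ *: z) => p q r.
    by rewrite !opprD !opprK addrACA [- q + p + r]addrAC addrA.
  rewrite E2 scalerDr scalerBr scalerN /w !scalerA; congr (_ - _ + _ *: _).
    by rewrite mulrC.
  by field; rewrite !gt_eqF.
clearbody w.
rewrite ipDr ipBr ipNr !ipZr -(ipE w) invfM.
move: mono; rewrite ipZr.
move: (ip w y) (h^-1 * ip w _) (`|w| ^+ 2) => A B C B0.
rewrite (_ : _ + _ = - (2 * s ^+ 2 * B) + 2 * (s / (s + h) * A)).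
  by rewrite gerDr oppr_le0 !mulr_ge0 ?(ltW s0).
field; rewrite !gt_eqF//.
Qed.

End Energy.

(** * Convergence rates *)

Section Rates.
Context (R : realType) (H : completeNormedModType R) (ip : {dot H for idfun}).
Hypothesis ipE : norm_induced_by ip.
Variable M : H -> H.
Hypothesis Mmono : monotone_operator ip M.
Hypothesis Mc : continuous M.
Variables (t0 : R) (x0 : H) (x : R -> H).
Hypothesis t0_gt0 : 0 < t0.
Hypothesis xsol : strong_global_solution M t0 x0 x.

Let g := velocity M x.

(** Local upper bound for the increments of [t ^+ 2 * `|velocity t| ^+ 2],
    obtained from [quotient_energy_bound] as the step tends to 0. *)
Lemma velocity_increment c e : t0 < c -> 0 < e ->
  exists2 d, 0 < d & forall u v, c - d < u -> u <= v -> v < c + d ->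
    v ^+ 2 * `|g v| ^+ 2 - u ^+ 2 * `|g u| ^+ 2 <=
    (2 * ip (g c) (x c) + e) * (v - u).
Proof.
move=> t0c e0; have c0 : 0 < c by exact: lt_trans t0c.
have fc : (2 * (p.1 / (p.1 + p.2) * ip (quotient x p.2 p.1) (x (p.1 + p.2))))
    @[p --> (nbhs c, (0 : R)^'+)] --> 2 * (c / (c + 0) * ip (g c) (x (c + 0))).
  have p1 : p.1 @[p --> (nbhs c, (0 : R)^'+)] --> c by exact: cvg_fst.
  have p2 : p.2 @[p --> (nbhs c, (0 : R)^'+)] --> (0 : R).
    apply: (cvg_trans (@cvg_snd _ _ _ _ _)); exact: cvg_within.
  have p12 : p.1 + p.2 @[p --> (nbhs c, (0 : R)^'+)] --> c + 0 by exact: cvgD.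
  apply: cvgM; first exact: cvg_cst.
  apply: cvgM.
    by apply: cvgM => //; apply: cvgV => //; rewrite addr0 gt_eqF.
  apply: (cvg_ip ipE); first exact: (quotient_cvg Mc t0_gt0 xsol t0c).
  apply: (cvg_comp _ _ p12); rewrite addr0.
  exact: (sol_continuous xsol t0c).
rewrite !addr0 divff ?gt_eqF// mul1r in fc.
have [[A B] /= [[d1 /= d10 hA] hB] AB] : \forall p \near (nbhs c, (0 : R)^'+),
    2 * (p.1 / (p.1 + p.2) * ip (quotient x p.2 p.1) (x (p.1 + p.2))) <
    2 * ip (g c) (x c) + e.
  by move/cvgr_lt : fc; apply; rewrite ltrDl.
pose d := Num.min d1 (c - t0).
have dd1 : d <= d1 by rewrite ge_min lexx.
have dt0 : d <= c - t0 by rewrite ge_min lexx orbT.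
exists d; first by rewrite lt_min d10 subr_gt0.
move=> u v cu uv vc.
have t0u : t0 < u by lra.
have lim w : t0 < w -> w ^+ 2 * `|quotient x h w| ^+ 2
    @[h --> (0 : R)^'+] --> w ^+ 2 * `|g w| ^+ 2.
  move=> t0w; apply: cvgM; first exact: cvg_cst.
  have q : `|quotient x h w| @[h --> (0 : R)^'+] --> `|g w|.
    by apply: cvg_norm; exact: (quotient_cvg_right Mc t0_gt0 xsol t0w).
  exact: (cvgM q q).
have limB := cvgB (lim v (lt_le_trans t0u uv)) (lim u t0u).
have limK : ((2 * ip (g c) (x c) + e) * (v - u)) @[_ --> (0 : R)^'+]
    --> (2 * ip (g c) (x c) + e) * (v - u) by exact: cvg_cst.
apply: (ler_cvg_to (limB _) limK).
near=> h.
have h0 : 0 < h by near: h; exact: nbhs_right_gt.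
have Bh : B h by near: h.
apply: (@derive_le_increment _
  (fun r => r ^+ 2 * `|quotient x h r| ^+ 2)
  (fun s => s ^+ 2 * (2 * ip (quotient x h s) (h^-1 *: (g (s + h) - g s))) +
    `|quotient x h s| ^+ 2 * (2 * s)) u v _ uv) => s /andP[us sv];
  have t0s : t0 < s by lra.
  exact: (quotient_energy_derive ipE Mc t0_gt0 xsol h0 t0s).
apply: (le_trans (quotient_energy_bound ipE Mmono x t0_gt0 h0 t0s)).
apply: ltW; apply: (AB (s, h)); split => //=; apply: hA.
by rewrite /ball /= ltr_norml; apply/andP; split; lra.
Unshelve. all: by end_near. Qed.

(** The matching lower bound for the increments of [`|x t| ^+ 2]. *)
Lemma sol_norm_increment c e : t0 < c -> 0 < e ->
  exists2 d, 0 < d & forall u v, c - d < u -> u <= v -> v < c + d ->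
    (2 * ip (x c) (g c) - e) * (v - u) <= `|x v| ^+ 2 - `|x u| ^+ 2.
Proof.
move=> t0c e0.
have fc : 2 * ip (x s) (g s) @[s --> c] --> 2 * ip (x c) (g c).
  apply: cvgM; first exact: cvg_cst.
  apply: (cvg_ip ipE); first exact: (sol_continuous xsol t0c).
  exact: (velocity_continuous Mc t0_gt0 xsol t0c).
have [d1 /= d10 hd1] : \forall s \near c,
    2 * ip (x c) (g c) - e < 2 * ip (x s) (g s).
  by move/cvgr_gt : fc; apply; rewrite ltrBlDr ltrDl.
pose d := Num.min d1 (c - t0).
have dd1 : d <= d1 by rewrite ge_min lexx.
have dt0 : d <= c - t0 by rewrite ge_min lexx orbT.
exists d; first by rewrite lt_min d10 subr_gt0.
move=> u v cu uv vc.
have : (- `|x v| ^+ 2) - (- `|x u| ^+ 2) <=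
   (- (2 * ip (x c) (g c) - e)) * (v - u).
  apply: (@derive_le_increment _ (fun s => - `|x s| ^+ 2)
    (fun s => - (2 * ip (x s) (g s)))) => // s /andP[us sv];
    have t0s : t0 < s by lra.
    apply: is_deriveN; apply: (is_derive_normr_sqr ipE).
    exact: (sol_is_derive Mc t0_gt0 xsol t0s).
  rewrite lerN2; apply: ltW; apply: hd1.
  by rewrite /ball /= ltr_norml; apply/andP; split; lra.
rewrite mulNr; move: (`|x v| ^+ 2) (`|x u| ^+ 2) (_ * (v - u)) => A B C.
by lra.
Qed.

Lemma velocity_energy_nonincreasing a b : t0 < a -> a <= b ->
  b ^+ 2 * `|g b| ^+ 2 - `|x b| ^+ 2 <= a ^+ 2 * `|g a| ^+ 2 - `|x a| ^+ 2.
Proof.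
move=> t0a ab.
pose F t := t ^+ 2 * `|g t| ^+ 2 - `|x t| ^+ 2.
rewrite -/(F a) -/(F b) -subr_le0; apply/ler_addgt0Pr => e e0; rewrite add0r.
have q0 : 0 < b - a + 1 by lra.
pose e' := e / (b - a + 1) / 2.
have e'0 : 0 < e' by rewrite !divr_gt0.
apply: (@le_trans _ _ (2 * e' * (b - a))); last first.
  rewrite /e' mulrC [2 * _]mulrC divfK// mulrA ler_pdivrMr//.
  by rewrite mulrC ler_pM2l// lerDl.
apply: (@interval_cousin _ (fun u v => F v - F u <= 2 * e' * (v - u)) a b ab).
  by move=> u v w _ _; move: (F u) (F v) (F w) => ? ? ?; lra.
move=> c ac cb; have t0c : t0 < c by lra.
have [d1 d10 h1] := velocity_increment t0c e'0.
have [d2 d20 h2] := sol_norm_increment t0c e'0.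
exists (Num.min d1 d2); first by rewrite lt_min d10.
move=> u v au cu uc cv vc vb.
have m1 : Num.min d1 d2 <= d1 by rewrite ge_min lexx.
have m2 : Num.min d1 d2 <= d2 by rewrite ge_min lexx orbT.
have uv := le_trans uc cv.
have := h1 u v ltac:(lra) uv ltac:(lra).
have := h2 u v ltac:(lra) uv ltac:(lra).
rewrite /F (ipC ip (g c)).
move: (ip _ _) (v ^+ 2 * _) (u ^+ 2 * _) (`|x v| ^+ 2) (`|x u| ^+ 2).
by move=> p A B C D; lra.
Qed.

Lemma velocity_rate a : Zer M !=set0 -> t0 < a ->
  exists2 C, 0 < C & forall t, a <= t -> `|g t| <= C * t^-1.
Proof.
move=> Z0 t0a; have [B B0 hB] := sol_bounded ipE Mmono Mc t0_gt0 xsol Z0 t0a.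
pose Q := B ^+ 2 + a ^+ 2 * `|g a| ^+ 2.
have Q0 : 0 <= Q.
  by apply: addr_ge0; [exact: sqr_ge0 | apply: mulr_ge0; exact: sqr_ge0].
exists (Q + 1); first by rewrite ltr_pwDr.
move=> t at_.
have t_gt0 : 0 < t by rewrite (lt_trans t0_gt0)// (lt_le_trans t0a).
rewrite ler_pdivlMr//.
have xB : `|x t| ^+ 2 <= B ^+ 2 by rewrite lerXn2r ?nnegrE ?hB// ltW.
have hQ : (`|g t| * t) ^+ 2 <= Q.
  rewrite exprMn; have := velocity_energy_nonincreasing t0a at_.
  rewrite /Q; have := sqr_ge0 `|x a|; move: xB.
  move: (`|x a| ^+ 2) (`|x t| ^+ 2) (`|g t| ^+ 2) (`|g a| ^+ 2) => A C D E.
  lra.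
rewrite leNgt; apply/negP; move: hQ; move: (`|g t| * t) => A hQ hA.
nra.
Qed.

Lemma operator_rate a : Zer M !=set0 -> t0 < a ->
  exists2 C, 0 < C & forall t, a <= t -> `|M (x t)| <= C * t^-1.
Proof.
move=> Z0 t0a; have [B B0 hB] := sol_bounded ipE Mmono Mc t0_gt0 xsol Z0 t0a.
have [C C0 hC] := velocity_rate Z0 t0a.
exists (C + B); first exact: addr_gt0.
move=> t at_.
have t_gt0 : 0 < t by rewrite (lt_trans t0_gt0)// (lt_le_trans t0a).
have -> : M (x t) = - (g t + t^-1 *: x t).
  by rewrite /g /velocity subrK opprK.
rewrite normrN (le_trans (ler_normD _ _))// mulrDl lerD ?hC//.
by rewrite normrZ gtr0_norm ?invr_gt0// mulrC ler_pM2r ?invr_gt0// hB.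
Qed.

End Rates.

(** * Strong convergence to the zero of least norm *)

Section StrongConvergence.
Context (R : realType) (H : completeNormedModType R) (ip : {dot H for idfun}).
Hypothesis ipE : norm_induced_by ip.
Variable M : H -> H.
Hypothesis Mmono : monotone_operator ip M.
Hypothesis Mc : continuous M.
Variables (t0 : R) (x0 : H) (x : R -> H).
Hypothesis t0_gt0 : 0 < t0.
Hypothesis xsol : strong_global_solution M t0 x0 x.
Variable xi : H.
Hypothesis Zxi : Zer M xi.
Hypothesis xi_min : forall z, Zer M z -> `|xi| <= `|z|.

(** Weak limit points of the trajectory satisfy the variational inequality for
    [xi]; this is its quantitative form, free of weak topologies. *)
Lemma sol_weak_limsup e : 0 < e ->
  \forall t \near +oo, ip xi (xi - x t) <= e.
Proof.
move=> e0.
have Z0 : Zer M !=set0 by exists xi.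
pose a := t0 + 1; have t0a : t0 < a by rewrite ltrDl.
have [B B0 hB] := sol_bounded ipE Mmono Mc t0_gt0 xsol Z0 t0a.
have [K K0 hK] := operator_rate ipE Mmono Mc t0_gt0 xsol Z0 t0a.
apply: contrapT => notnear.
have often T : exists2 t, T <= t & e < ip xi (xi - x t).
  apply: contrapT => h; apply: notnear; exists T; split; first exact: num_real.
  move=> t Tt; rewrite leNgt; apply/negP => et; apply: h.
  by exists t => //; exact: ltW.
(* [C n] collects the conditions met by [x t], for arbitrarily large [t] with
   [`|M (x t)| <= n.+1%:R^-1]. *)
pose C (n : nat) := [set z : H | ip xi (z - xi) <= - e /\
  forall y, ip (M y) (z - y) <= n.+1%:R^-1 * (B + `|y|)].
have [||||z zC _] := nested_convex_min_norm ipE (C := C) (B := B).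
- move=> n.
  have -> : C n = [set z | ip xi (z - xi) <= - e] `&`
      \bigcap_y [set z | ip (M y) (z - y) <= n.+1%:R^-1 * (B + `|y|)].
    apply/seteqP; split => z [h1 h2]; split => // y.
      by move=> _; exact: h2.
    exact: (h2 y I).
  apply: closedI; first exact: closed_ip_le.
  by apply: closed_bigI => y _; exact: closed_ip_le.
- move=> n u v [u1 u2] [v1 v2]; split; first exact: midpoint_ip_le.
  by move=> y; apply: midpoint_ip_le.
- move=> n m nm z [z1 z2]; split => // y; apply: (le_trans (z2 y)).
  rewrite ler_wpM2r// ?addr_ge0// ?(ltW B0)//.
  by rewrite lef_pV2 ?posrE// ler_nat ltnS.
- move=> n; have [t tT et] := often (Num.max a (K * n.+1%:R)).
  have at_ : a <= t by rewrite (le_trans _ tT)// le_max lexx.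
  have Kt : K * n.+1%:R <= t by rewrite (le_trans _ tT)// le_max lexx orbT.
  have t_gt0 : 0 < t by rewrite (lt_trans t0_gt0)// (lt_le_trans t0a).
  exists (x t); last exact: hB.
  split; first by rewrite -opprB ipNr lerN2 ltW.
  move=> y; apply: (@le_trans _ _ (ip (M (x t)) (x t - y))).
    by have := Mmono (x t) y; rewrite ipBl subr_ge0.
  apply: (le_trans (ip_le_norm ipE _ _)); apply: ler_pM => //.
    apply: (le_trans (hK t at_)).
    by rewrite ler_pdivrMr// mulrC ler_pdivlMr.
  by apply: (le_trans (ler_normB _ _)); rewrite lerD2r hB.
have Zz : Zer M z.
  apply: (Minty_Zer ipE Mc) => y.
  have lim : n.+1%:R^-1 * (B + `|y|) @[n --> \oo] --> (0 : R).
    rewrite -(mul0r (B + `|y|)); apply: cvgM; last exact: cvg_cst.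
    exact: cvg_harmonic.
  apply: (ler_cvg_to (cvg_cst (ip (M y) (z - y))) lim).
  by apply: nearW => n; have [_] := zC n; exact.
have [+ _] := zC 0%N; rewrite -opprB ipNr lerN2 => h.
have := min_norm_zer_variational ipE Mmono Mc Zxi xi_min Zz.
by rewrite leNgt (lt_le_trans e0 h).
Qed.

Lemma sol_cvg_min_norm : x t @[t --> +oo] --> xi.
Proof.
apply/cvgrPdist_lt => r r0.
(* For large [t], [`|x t - xi| ^+ 2 <= e + K / t ^+ 2], and [2 * e < r ^+ 2] leaves
   room for the transient term [K / t ^+ 2]. *)
pose e := r ^+ 2 / 4; have e0 : 0 < e by rewrite divr_gt0// exprn_gt0.
have [N [_ hN]] := sol_weak_limsup e0.
pose T := Num.max (N + 1) (t0 + 1).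
have t0T : t0 < T by rewrite lt_max ltrDl ltr01 orbT.
have NT t : T <= t -> N < t.
  by apply: lt_le_trans; rewrite lt_max ltrDl ltr01.
pose K := T ^+ 2 * `|x T - xi| ^+ 2.
near=> t.
have Tt : T <= t by near: t; apply: nbhs_pinfty_ge; exact: num_real.
have t1 : 1 <= t by near: t; apply: nbhs_pinfty_ge; exact: num_real.
have Kt : K / e <= t by near: t; apply: nbhs_pinfty_ge; exact: num_real.
have := @weighted_dist_decay _ _ _ ipE _ Mc _ _ _ t0_gt0 xsol 1 e xi T t t0T Tt.
have decay s : T <= s -> s <= t -> 2 * s * ip (x s - xi) (velocity M x s) <=
    - 2%:R * (`|x s - xi| ^+ 2 - e).
  move=> Ts _; have t0s : t0 < s by exact: lt_le_trans Ts.
  have := dist_zero_velocity Mmono x t0_gt0 t0s Zxi.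
  have := hN s (NT s Ts).
  rewrite (ipE (x s - xi)) (ipBl ip (x s) xi (x s - xi)).
  rewrite -[xi - x s]opprB ipNr.
  by move: (ip _ _) (ip _ _) (ip _ _) => A D E; lra.
move=> /(_ decay) h.
have {}Kt : K <= t ^+ 2 * e.
  rewrite ler_pdivrMr// in Kt; apply: (le_trans Kt).
  by rewrite ler_pM2r// expr2 ler_peMl// (le_trans _ t1).
have T2 : 0 <= T ^+ 2 * e by rewrite mulr_ge0 ?sqr_ge0// ltW.
have t2 : 0 < t ^+ 2 by rewrite exprn_gt0// (lt_le_trans _ t1).
have phi : `|x t - xi| ^+ 2 <= 2 * e.
  rewrite -(ler_pM2l t2); move: h Kt T2; rewrite /K.
  move: (`|x t - xi| ^+ 2) (`|x T - xi| ^+ 2) (t ^+ 2) (T ^+ 2) => A D E F.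
  lra.
rewrite distrC -(ltr_pXn2r (n := 2))// ?nnegrE ?(ltW r0)//.
apply: (le_lt_trans phi); rewrite /e.
have : 0 < r ^+ 2 by rewrite exprn_gt0.
lra.
Unshelve. all: by end_near. Qed.

End StrongConvergence.

Theorem theorem2p4 (R : realType) (H : completeNormedModType R)
    (ip : {dot H for idfun}) (ip_norm : norm_induced_by ip)
    (M : H -> H) (M_monotone : monotone_operator ip M)
    (M_continuous : continuous M) (Zer_nonempty : Zer M !=set0)
    (t0 : R) (t0_gt0 : 0 < t0) (x0 : H) (x : R -> H)
    (x_sol : trajectory_solution M t0 x0 x) :
  [/\ (fun t : R => `|derive1 x t|) =O_ (ae_pinfty R) (fun t : R => t^-1),
      (fun t : R => `|M (x t)|) =O_ (pinfty_nbhs R) (fun t : R => t^-1) &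
      exists xi : H,
        metric_projection (Zer M) 0 = [set xi] /\ x t @[t --> +oo] --> xi].
Proof.
have [xsol _] := x_sol.
have t0a : t0 < t0 + 1 by rewrite ltrDl.
split.
- have [C C0 hC] := velocity_rate ip_norm M_monotone M_continuous t0_gt0 xsol
    Zer_nonempty t0a.
  apply/eqO_exP; exists C => //; exists (t0 + 1); apply: aeW => t lt_t.
  have t0t : t0 < t by exact: lt_trans lt_t.
  have [_ xD] := sol_is_derive M_continuous t0_gt0 xsol t0t.
  rewrite derive1E xD normr_id ger0_norm ?invr_ge0 ?(ltW (lt_trans t0_gt0 t0t))//.
  exact/hC/ltW.
- have [C C0 hC] := operator_rate ip_norm M_monotone M_continuous t0_gt0 xsol
    Zer_nonempty t0a.
  apply/eqO_exP; exists C => //; exists (t0 + 1); split; first exact: num_real.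
  move=> t lt_t; have t0t : t0 < t by exact: lt_trans lt_t.
  rewrite normr_id ger0_norm ?invr_ge0 ?(ltW (lt_trans t0_gt0 t0t))//.
  exact/hC/ltW.
- have [xi Zxi xi_min] := Zer_min_norm ip_norm M_monotone M_continuous Zer_nonempty.
  exists xi; split; first exact: (metric_projection_Zer ip_norm).
  exact: (sol_cvg_min_norm ip_norm M_monotone M_continuous t0_gt0 xsol).
Qed.
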